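(* Let $\Omega=\{1,\dots,d\}^{\mathbb N}$ with the shift $\sigma$, let $A:\Omega\to\mathbb R$ be Lipschitz continuous, let $h$ be the Peierls barrier of $A$ and $\mathcal A$ the Aubry set of $A$. Then for any $x\in\mathcal A$, $h(x,\sigma(x))+h(\sigma(x),x)=0$.
   Context: $\Omega$ carries the metric $d(x,y)=2^{-\min\{n:\ x_n\ne y_n\}}$ and $\sigma(x_0x_1x_2\ldots)=x_1x_2\ldots$. $m(A)=\max\int A\,d\nu$ over $\sigma$-invariant Borel probability measures $\nu$. $S_n(f)=f+f\circ\sigma+\dots+f\circ\sigma^{n-1}$. The Peierls barrier is $$h(x,y)=\lim_{\epsilon\to0}\ \limsup_{n\to\infty}\ \sup\{S_n(A-m(A))(z):\ z\in\Omega,\ \sigma^n(z)=y,\ d(x,z)<\epsilon\}\in[-\infty,+\infty).$$ The Mañé potential is $S_A(x,y)=\lim_{\epsilon\to0}\sup\{S_n(A-m(A))(z):\ n\ge1,\ \sigma^n(z)=y,\ d(z,x)<\epsilon\}$, and the Aubry set is $\mathcal A=\{x\in\Omega:\ S_A(x,x)=0\}$. *)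

(* Defs.v *)
From HB Require Import structures.
From mathcomp Require Import all_boot all_order all_algebra.
From mathcomp Require Import all_classical all_reals all_analysis.

Set Implicit Arguments.
Unset Strict Implicit.
Unset Printing Implicit Defensive.

Import Order.TTheory GRing.Theory Num.Theory.
Import numFieldNormedType.Exports.

Local Open Scope classical_set_scope.
Local Open Scope ring_scope.

(* The full shift on d.+1 symbols, so that d ranging over nat covers every
   nonempty finite alphabet.  R is a phantom parameter: it is the field in
   which the canonical distance below takes its values. *)
Definition shift_space (R : realType) (d : nat) : Type := nat -> 'I_d.+1.

HB.instance Definition _ (R : realType) (d : nat) :=
  Choice.copy (shift_space R d) (nat -> 'I_d.+1).
HB.instance Definition _ (R : realType) (d : nat) :=
  isPointed.Build (shift_space R d) (fun=> ord0).

Section shift_metric.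
Context {R : realType} {d : nat}.
Implicit Types x y z : shift_space R d.

(* The first branch is 2 ^- min {n | x n != y n}. *)
Definition shift_dist x y : R :=
  if pselect (exists n, x n != y n) is left xy then 2 ^- ex_minn xy else 0.

Lemma shift_dist_ltP x y n :
  reflect (forall i, (i <= n)%N -> x i = y i) (shift_dist x y < 2 ^- n).
Proof.
rewrite /shift_dist; case: pselect => [xy|nxy].
  case: ex_minnP => m xym m_min.
  rewrite ltf_pV2 ?posrE ?exprn_gt0 // ltr_eXn2l ?ltr1n //.
  apply: (iffP idP) => [nm i ile|eq_xy].
    apply/eqP; apply: contraTT (leq_ltn_trans ile nm) => /m_min.
    by rewrite -leqNgt.
  by rewrite ltnNge; apply: contra xym => /eq_xy ->.
rewrite invr_gt0 exprn_gt0 //; constructor=> i _.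
by apply/eqP/negPn/negP => xyi; apply: nxy; exists i.
Qed.

Lemma shift_dist_xx x : shift_dist x x = 0.
Proof.
rewrite /shift_dist; case: pselect => // xx; exfalso; case: xx => n.
by rewrite eqxx.
Qed.

Lemma shift_dist_eq0 x y : shift_dist x y = 0 -> x = y.
Proof.
move=> xy0; apply/funext => n; apply: (shift_dist_ltP x y n _) => //.
by rewrite xy0 invr_gt0 exprn_gt0.
Qed.

Lemma shift_dist_sym x y : shift_dist x y = shift_dist y x.
Proof.
rewrite /shift_dist; case: pselect => [xy|nxy]; case: pselect => [yx|nyx].
- by congr (2 ^- _); apply: eq_ex_minn => n; rewrite eq_sym.
- by exfalso; apply: nyx; case: xy => n; exists n; rewrite eq_sym.
- by exfalso; apply: nxy; case: yx => n; exists n; rewrite eq_sym.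
- by [].
Qed.

Lemma shift_dist_ge0 x y : 0 <= shift_dist x y.
Proof. by rewrite /shift_dist; case: pselect => // xy; rewrite invr_ge0 exprn_ge0. Qed.

Lemma shift_dist_triangle y x z :
  shift_dist x z <= shift_dist x y + shift_dist y z.
Proof.
rewrite {1}/shift_dist; case: pselect => [xz|_]; last first.
  by rewrite addr_ge0 ?shift_dist_ge0.
case: ex_minnP => m xzm _; rewrite leNgt; apply/negP => lt_m.
have xy : shift_dist x y < 2 ^- m.
  by apply: le_lt_trans lt_m; rewrite lerDl shift_dist_ge0.
have yz : shift_dist y z < 2 ^- m.
  by apply: le_lt_trans lt_m; rewrite lerDr shift_dist_ge0.
move/shift_dist_ltP: xy => xy; move/shift_dist_ltP: yz => yz.
by move: xzm; rewrite xy // yz // eqxx.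
Qed.

End shift_metric.

HB.instance Definition _ (R : realType) (d : nat) :=
  isMetric.Build R (shift_space R d) (@shift_dist_xx R d) (@shift_dist_eq0 R d)
    (@shift_dist_sym R d) (@shift_dist_triangle R d).

Section aubry_mather.
Context {R : realType} {d : nat}.
Local Notation Omega := (shift_space R d).
Implicit Types (A f : Omega -> R) (x y z : Omega).

Definition shift_map x : Omega := fun n => x n.+1.

(* Omega equipped with its Borel sigma-algebra. *)
Definition borel_shift := g_sigma_algebraType (@open Omega).

Definition shift_invariant (nu : probability borel_shift R) : Prop :=
  forall B : set borel_shift, measurable B ->
    pushforward nu (shift_map : borel_shift -> borel_shift) B = nu B.

(* For continuous A this supremum is attained (the invariant probabilities form
   a nonempty weakly compact set), so it is the maximum of the integrals. *)
Definition max_integral A : R :=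
  sup [set \int[nu]_(z in [set: borel_shift]) A z
      | nu in [set nu : probability borel_shift R | shift_invariant nu]].

Definition lipschitz_potential A : Prop :=
  exists L : R, forall x y, `|A x - A y| <= L * mdist x y.

Definition birkhoff_sum f (n : nat) z : R := \sum_(i < n) f (iter i shift_map z).

Definition normalized A : Omega -> R := fun z => A z - max_integral A.

Definition peierls_barrier A x y : \bar R :=
  lim (limn_esup (fun n : nat =>
         ereal_sup [set (birkhoff_sum (normalized A) n z)%:E
                   | z in [set z | iter n shift_map z = y /\ mdist x z < e]])
       @[e --> (0 : R)^'+]).

Definition mane_potential A x y : \bar R :=
  lim (ereal_sup [set s : \bar R | exists (n : nat) (z : Omega),
         [/\ (1 <= n)%N, iter n shift_map z = y, mdist z x < e &
             s = (birkhoff_sum (normalized A) n z)%:E]]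
       @[e --> (0 : R)^'+]).

Definition aubry_set A : set Omega := [set x | mane_potential A x x = 0%E].

End aubry_mather.

(* Main.v *)
(* Write F for A - m(A) and s for the shift.  F has nonpositive Birkhoff sums
   along periodic orbits, since a periodic orbit carries an invariant
   probability.  A return trip x -> y -> x made of two orbit segments with small
   jumps is shadowed by a periodic orbit, at a total cost controlled by the
   Lipschitz constant; hence h(x, y) + h(y, x) <= 0 for all x, y.  Conversely, if
   x is in the Aubry set, repeating one almost optimal return to x many times
   yields arbitrarily long almost optimal returns to x.  Appending the step
   x -> s x to them gives h(x, s x) >= F x, and deleting their first step gives
   h(s x, x) >= - F x. *)
Require Import Defs.
From mathcomp Require Import all_boot all_order all_algebra.
From mathcomp Require Import all_classical all_reals all_analysis.
From mathcomp Require Import measurable_realfun.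
From mathcomp Require Import lra.

Set Implicit Arguments.
Unset Strict Implicit.
Unset Printing Implicit Defensive.

Import Order.TTheory GRing.Theory Num.Theory.
Import numFieldNormedType.Exports.

Local Open Scope classical_set_scope.
Local Open Scope ring_scope.

Section empirical_measure.
Context {disp : measure_display} {T : measurableType disp} {R : realType}.
Variables (p : nat -> T) (n : nat).

Let dirac_sum : {measure set T -> \bar R} := msum (fun i => \d_(p i)) n.+1.

Definition empirical_measure : probability T R := mnormalize dirac_sum \d_(p 0).

Lemma empirical_measureE (B : set T) :
  empirical_measure B = (n.+1%:R^-1%:E * \sum_(i < n.+1) \d_(p i) B)%E.
Proof.
have sumT : dirac_sum setT = n.+1%:R%:E.
  rewrite /= /msum /=.
  under eq_bigr do rewrite diracT.
  by rewrite sumEFin sumr_const card_ord.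
by rewrite /= /mnormalize sumT /= eqe pnatr_eq0 /= muleC.
Qed.

Lemma Rintegral_empirical_measure (f : T -> R) (M : R) :
  measurable_fun setT f -> (forall z, `|f z| <= M) ->
  \int[empirical_measure]_(z in setT) f z =
  n.+1%:R^-1 * \sum_(i < n.+1) f (p i).
Proof.
move=> mf fM.
have int_f : empirical_measure.-integrable setT (EFin \o f).
  apply: measurable_bounded_integrable => //; first by apply: (le_lt_trans (probability_le1 empirical_measure measurableT)); rewrite ltry.
  exists M; split; first exact: num_real.
  by move=> x Mx y _ /=; rewrite (le_trans (fM y)) ?ltW.
have int_M : empirical_measure.-integrable setT (EFin \o cst M).
  exact: finite_measure_integrable_cst.
have n1_ge0 : 0 <= n.+1%:R^-1 :> R by rewrite invr_ge0.
(* The library's integrals against msum and mscale require f >= 0. *)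
suff shifted : \int[empirical_measure]_(z in setT) (f z + M) =
    n.+1%:R^-1 * \sum_(i < n.+1) f (p i) + M.
  move: shifted; rewrite RintegralD // Rintegral_cst // => /eqP.
  rewrite (_ : fine _ = 1) ?mulr1; last exact: (congr1 fine (probability_setT empirical_measure)).
  by move=> /eqP /addIr.
have fM_ge0 z : 0 <= f z + M by have := fM z; rewrite ler_norml => /andP[]; lra.
have /measurable_EFinP mfM : measurable_fun setT (fun z => f z + M).
    exact: measurable_funD.
  rewrite /Rintegral.
rewrite (@eq_measure_integral _ _ _ _ (mscale (NngNum n1_ge0) dirac_sum)); last first.
  by move=> B mB _; rewrite [LHS]empirical_measureE.
rewrite ge0_integral_mscale //; last by move=> z _; rewrite lee_fin.
rewrite ge0_integral_measure_sum //; last by move=> z _; rewrite lee_fin.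
under eq_bigr do rewrite integral_dirac // diracT mul1e.
rewrite sumEFin /= big_split /= sumr_const card_ord mulrDr -[M *+ _]mulr_natr.
by rewrite [M * _]mulrC mulKf ?pnatr_eq0.
Qed.

End empirical_measure.

Lemma ereal_supD_le (R : realType) (P Q : set R) (c : R) :
  (forall p q, P p -> Q q -> p + q <= c) ->
  (ereal_sup (EFin @` P) + ereal_sup (EFin @` Q) <= c%:E)%E.
Proof.
move=> PQc.
have supQ p : P p -> (ereal_sup (EFin @` Q) <= (c - p)%:E)%E.
  move=> Pp; apply: ge_ereal_sup => _ [q Qq <-].
  by rewrite lee_fin lerBrDl PQc.
have [->|/set0P[p Pp]] := eqVneq P set0; first by rewrite image_set0 ereal_sup0 addNye leNye.
move: supQ; case: (ereal_sup (EFin @` Q)) => [r| |] supQ.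
- rewrite -leeBrDr // -EFinB; apply: ge_ereal_sup => _ [p' /supQ + <-].
  by rewrite !lee_fin; lra.
- by have := supQ p Pp; rewrite leye_eq.
- by rewrite addeNy leNye.
Qed.

Section shift_orbits.
Context {R : realType} {d : nat}.
Local Notation Omega := (shift_space R d).
Local Notation sigma := (@shift_map R d).
Implicit Types (f : Omega -> R) (x y z w : Omega).

Definition agree_upto (k : nat) x y := forall i, (i <= k)%N -> x i = y i.

Lemma agree_uptoW k l x y : (k <= l)%N -> agree_upto l x y -> agree_upto k x y.
Proof. by move=> kl xy i ik; apply: xy; exact: leq_trans kl. Qed.

Lemma agree_upto_trans k y x z :
  agree_upto k x y -> agree_upto k y z -> agree_upto k x z.
Proof. by move=> xy yz i ik; rewrite xy // yz. Qed.

Lemma agree_upto_mdist k x y : agree_upto k x y <-> mdist x y < 2 ^- k.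
Proof. by split=> [|xy]; [move=> /shift_dist_ltP | exact/shift_dist_ltP]. Qed.

Lemma mdist_le1 x y : mdist x y <= 1.
Proof.
rewrite /mdist /= /shift_dist; case: pselect => [xy|_]; last exact: ler01.
by rewrite invf_le1 ?exprn_gt0 // exprn_ege1 // ler1n.
Qed.

Lemma exists_exp2V_small (L e : R) : 0 <= L -> 0 < e ->
  exists k : nat, 2 ^- k < e /\ L * 2 ^- k <= e.
Proof.
move=> L0 e0; have L1 : 0 < L + 1 by lra.
have eL0 : 0 < e / (L + 1) by rewrite divr_gt0.
exists (Num.bound (e / (L + 1))^-1); set k := Num.bound _.
have : 2 ^- k < e / (L + 1).
  by rewrite invf_plt ?posrE ?exprn_gt0 // upper_nthrootP.
have : 0 < 2 ^- k :> R by rewrite invr_gt0 exprn_gt0.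
by rewrite ltr_pdivlMr // => k0 kL; split; nra.
Qed.

Lemma iter_shift_mapE n z i : iter n sigma z i = z (n + i)%N.
Proof. by elim: n i => //= n IH i; rewrite /shift_map IH addnS. Qed.

Lemma birkhoff_sumD f n m z :
  birkhoff_sum f (n + m) z = birkhoff_sum f n z + birkhoff_sum f m (iter n sigma z).
Proof.
rewrite /birkhoff_sum big_split_ord /=; congr (_ + _).
by apply: eq_bigr => i _; rewrite -iterD addnC.
Qed.

Definition splice (n : nat) z w : Omega :=
  fun i => if (i < n)%N then z i else w (i - n)%N.

Lemma iter_splice n z w : iter n sigma (splice n z w) = w.
Proof.
by apply/funext => i; rewrite iter_shift_mapE /splice ltnNge leq_addr /= addKn.
Qed.

Lemma agree_splice k n z w :
  agree_upto k (iter n sigma z) w -> agree_upto (n + k) z (splice n z w).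
Proof.
move=> zw i ink; rewrite /splice; case: ltnP => // ni.
by rewrite -zw ?leq_subLR // iter_shift_mapE subnKC.
Qed.

Definition periodize (n : nat) z : Omega := fun i => z (i %% n)%N.

Lemma iter_periodize n z : iter n sigma (periodize n z) = periodize n z.
Proof. by apply/funext => i; rewrite iter_shift_mapE /periodize modnDl. Qed.

(* Anosov closing: an orbit returning near its start is shadowed by the
   periodic orbit repeating its first n symbols. *)
Lemma agree_periodize k n z : (0 < n)%N ->
  agree_upto k (iter n sigma z) z -> agree_upto (n + k) z (periodize n z).
Proof.
move=> n0 zz; elim/ltn_ind => i IH ink; rewrite /periodize.
have [lt_in|le_ni] := ltnP i n; first by rewrite modn_small.
have ink' : (i - n <= k)%N by rewrite leq_subLR.
rewrite -{1}(subnKC le_ni) -iter_shift_mapE zz // IH ?ltn_subrL ?n0 ?(leq_trans n0) //.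
  by rewrite /periodize -{2}(subnKC le_ni) modnDl.
by rewrite (leq_trans (leq_subr _ _)).
Qed.

Section distortion.
Variables (f : Omega -> R) (L : R).
Hypothesis L_ge0 : 0 <= L.
Hypothesis f_lip : forall x y, `|f x - f y| <= L * mdist x y.

(* The i-th iterates agree up to rank n + k - i, so the errors form a geometric
   series. *)
Lemma birkhoff_sum_distortion k n z w : agree_upto (n + k) z w ->
  `|birkhoff_sum f n z - birkhoff_sum f n w| <= L * 2 ^- k.
Proof.
move=> zw; suff: `|birkhoff_sum f n z - birkhoff_sum f n w| <=
    L * (2 ^- k - 2 ^- (n + k)).
  by move/le_trans; apply; rewrite ler_wpM2l // gerBl invr_ge0 exprn_ge0.
elim: n z w zw => [|n IH] z w zw.
  by rewrite /birkhoff_sum !big_ord0 !subrr normr0 mulr0.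
rewrite -add1n !birkhoff_sumD.
have zw' : agree_upto (n + k) (iter 1 sigma z) (iter 1 sigma w).
  by move=> i ink; rewrite !iter_shift_mapE zw.
have /IH := zw'; set a := birkhoff_sum f n _; set b := birkhoff_sum f n _.
have -> v : birkhoff_sum f 1 v = f v by rewrite /birkhoff_sum big_ord1.
have -> v : birkhoff_sum f 1 v = f v by rewrite /birkhoff_sum big_ord1.
have fzw : `|f z - f w| <= L * 2 ^- (1 + n + k).
  apply: (le_trans (f_lip _ _)); rewrite ler_wpM2l // ltW //.
  exact/agree_upto_mdist.
have half : 2 ^- (n + k) = 2 * 2 ^- (1 + n + k) :> R.
  by rewrite -addnA add1n exprS invfM mulVKf.
move=> ab; apply: (@le_trans _ _ (`|f z - f w| + `|a - b|)).
  by rewrite opprD addrACA ler_normD.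
by apply: (le_trans (lerD fzw ab)); rewrite half -mulrDr ler_wpM2l //; lra.
Qed.

Hypothesis f_periodic : forall n z, (0 < n)%N -> iter n sigma z = z ->
  birkhoff_sum f n z <= 0.

Lemma birkhoff_sum_near_return k n z :
  agree_upto k (iter n sigma z) z -> birkhoff_sum f n z <= L * 2 ^- k.
Proof.
case: n => [_|n zz]; first by rewrite /birkhoff_sum big_ord0 mulr_ge0 // invr_ge0 exprn_ge0.
have := birkhoff_sum_distortion (agree_periodize (ltn0Sn n) zz).
rewrite ler_norml => /andP[_].
by have := f_periodic (ltn0Sn n) (iter_periodize n.+1 z); lra.
Qed.

Lemma birkhoff_sum_roundtrip k n m x y z w :
  iter n sigma z = y -> agree_upto k x z ->
  iter m sigma w = x -> agree_upto k y w ->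
  birkhoff_sum f n z + birkhoff_sum f m w <= L * 2 ^- k *+ 2.
Proof.
move=> zy xz wx yw; set q := splice n z w.
have zq : agree_upto (n + k) z q by apply: agree_splice; rewrite zy.
have /birkhoff_sum_near_return : agree_upto k (iter (n + m) sigma q) q.
  rewrite addnC iterD iter_splice wx; apply: agree_upto_trans xz _.
  exact: agree_uptoW (leq_addl _ _) zq.
rewrite birkhoff_sumD iter_splice.
have := birkhoff_sum_distortion zq; rewrite ler_norml => /andP[_].
by rewrite mulr2n; lra.
Qed.

Lemma birkhoff_sum_repeat k n j x z :
  iter n sigma z = x -> agree_upto k x z ->
  exists u, [/\ iter (j * n) sigma u = x, agree_upto k x u &
    (birkhoff_sum f n z - L * 2 ^- k) *+ j <= birkhoff_sum f (j * n) u].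
Proof.
move=> zx xz; elim: j => [|j [u [ux xu le_u]]].
  by exists x; split => //; rewrite /birkhoff_sum big_ord0 mulr0n.
have zu : agree_upto (n + k) z (splice n z u) by apply: agree_splice; rewrite zx.
exists (splice n z u); split.
- by rewrite mulSn addnC iterD iter_splice.
- by apply: agree_upto_trans xz _; exact: agree_uptoW (leq_addl _ _) zu.
- rewrite mulSn birkhoff_sumD iter_splice mulrS lerD //.
  by have := birkhoff_sum_distortion zu; rewrite ler_norml => /andP[_]; lra.
Qed.

End distortion.

Section max_integral_bound.
Variable A : Omega -> R.
Hypothesis hA : lipschitz_potential A.

Let B := @borel_shift R d.

Lemma lipschitz_constant_ge0 :
  exists2 L : R, 0 <= L & forall x y, `|A x - A y| <= L * mdist x y.
Proof.
have [L AL] := hA; exists `|L| => // x y; apply: (le_trans (AL x y)).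
by rewrite ler_wpM2r ?mdist_ge0 // ler_norm.
Qed.

Lemma lipschitz_potential_bounded : exists M : R, forall z, `|A z| <= M.
Proof.
have [L L0 AL] := lipschitz_constant_ge0.
exists (`|A point| + L) => z; rewrite -[A z](subrK (A point)) addrC.
apply: (le_trans (ler_normD _ _)); rewrite lerD2l.
apply: (le_trans (AL _ _)); rewrite -[leRHS]mulr1 ler_wpM2l //.
exact: mdist_le1.
Qed.

Lemma lipschitz_potential_continuous : continuous A.
Proof.
have [L L0 AL] := lipschitz_constant_ge0.
have L1 : 0 < L + 1 by lra.
move=> z; apply/(@cvgrPdist_lt _ _ _ (nbhs (z : Omega)) _ A (A z)) => e e0; apply/nbhs_ballP.
exists (e / (L + 1)); rewrite /= ?divr_gt0 // => t.
rewrite ballEmdist /= ltr_pdivlMr // mulrC => zt.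
apply: le_lt_trans zt; apply: (le_trans (AL z t)).
by rewrite ler_wpM2r ?mdist_ge0 //; lra.
Qed.

Lemma lipschitz_potential_measurable :
  measurable_fun [set: B] (A : B -> R).
Proof.
have /continuousP openA := lipschitz_potential_continuous.
apply: (measurability _ (RGenOpens.measurableE R)).
move=> _ [_ [a [b ->] <-]]; rewrite setTI.
by apply: sub_sigma_algebra; apply: openA; exact: interval_open.
Qed.

Lemma birkhoff_sum_normalized_periodic n z :
  (0 < n)%N -> iter n sigma z = z -> birkhoff_sum (normalized A) n z <= 0.
Proof.
case: n => // n _ zz.
have [M AM] := lipschitz_potential_bounded.
have mA := lipschitz_potential_measurable.
pose nu := @empirical_measure _ B R (fun i => iter i sigma z) n.
have inv_nu : shift_invariant nu.
  move=> C mC; rewrite /pushforward !empirical_measureE; congr (_ * _)%E.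
  rewrite [LHS]big_ord_recr [RHS]big_ord_recl /= addeC.
  congr (_ + _)%E.
  by rewrite !diracE /= -[in RHS]zz.
have int_A (mu : probability B R) : mu.-integrable setT (EFin \o (A : B -> R)).
  apply: measurable_bounded_integrable => //.
    by apply: (le_lt_trans (probability_le1 mu measurableT)); rewrite ltry.
  exists M; split; first exact: num_real.
  by move=> x Mx y _ /=; rewrite (le_trans (AM y)) ?ltW.
have int_M (mu : probability B R) : mu.-integrable setT (EFin \o (cst M : B -> R)).
  exact: finite_measure_integrable_cst.
have : \int[nu]_(t in [set: B]) A t <= max_integral A.
  apply: ub_le_sup; last by exists nu.
  exists M => _ [mu _ <-].
  have : \int[mu]_(t in [set: B]) A t <= \int[mu]_(t in [set: B]) M.
    apply: (le_Rintegral measurableT (int_A mu) (int_M mu)) => t _.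
    exact: le_trans (ler_norm _) (AM t).
  rewrite Rintegral_cst // (_ : fine _ = 1) ?mulr1 //.
  exact: (congr1 fine (probability_setT mu)).
rewrite (Rintegral_empirical_measure _ _ mA AM) ler_pdivrMl ?ltr0n //.
rewrite /birkhoff_sum /normalized big_split /= sumr_const card_ord.
by rewrite mulNrn subr_le0 mulr_natl.
Qed.

End max_integral_bound.

Section barriers.
Variables (A : Omega -> R) (x y : Omega).
Local Notation S := (birkhoff_sum (normalized A)).

Definition loop_set (e : R) (n : nat) : set Omega :=
  [set z | iter n sigma z = y /\ mdist x z < e].

Lemma peierls_barrierE : peierls_barrier A x y =
  ereal_inf [set limn_esup (fun n => ereal_sup [set (S n z)%:E | z in loop_set e n])
            | e in `]0, +oo[].
Proof.
apply/cvg_lim => //; apply: (nondecreasing_at_right_cvge (BInfty R false)) => // e1 e2 _ _ e12.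
apply: le_ereal_inf_tmp => _ /= [V Voo <-].
apply: ge_ereal_inf; eexists; first by exists V.
apply: ge_ereal_sup => _ /= [n Vn <-].
apply: le_ereal_sup_tmp; eexists; first by exists n.
apply: ereal_sup_le => _ /= [z [zy xz] <-]; exists z => //.
by split => //; exact: lt_le_trans xz e12.
Qed.

Lemma mane_potentialE : mane_potential A x y =
  ereal_inf [set ereal_sup [set s : \bar R | exists (n : nat) (z : Omega),
         [/\ (1 <= n)%N, iter n sigma z = y, mdist z x < e & s = (S n z)%:E]]
       | e in `]0, +oo[].
Proof.
apply/cvg_lim => //; apply: (nondecreasing_at_right_cvge (BInfty R false)) => // e1 e2 _ _ e12.
apply: ereal_sup_le => _ /= [n [z [n1 zy xz ->]]]; exists n, z; split => //.
exact: lt_le_trans xz e12.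
Qed.

Lemma peierls_barrier_ge (c : R) :
  (forall (e : R) (N : nat), 0 < e -> exists n z,
    [/\ (N <= n)%N, iter n sigma z = y, mdist x z < e & c - e <= S n z]) ->
  (c%:E <= peierls_barrier A x y)%E.
Proof.
move=> h; rewrite peierls_barrierE; apply: le_ereal_inf_tmp => _ [e /= e0 <-].
move: e0; rewrite in_itv /= andbT => e0.
apply: le_ereal_inf_tmp => _ /= [V [N _ NV] <-].
apply/lee_addgt0Pr => r r0.
have er0 : 0 < Num.min e r by rewrite lt_min e0.
have [n [z [Nn zy xz cS]]] := h (Num.min e r) N er0.
rewrite -leeBlDr // -EFinB; apply: (@le_trans _ _ (S n z)%:E).
  by rewrite lee_fin; apply: le_trans cS; rewrite lerD2l lerN2 ge_min lexx orbT.
apply: le_ereal_sup_tmp; eexists; first by exists n; first exact: NV.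
apply: ereal_sup_ubound; exists z => //; split => //.
by apply: (lt_le_trans xz); rewrite ge_min lexx.
Qed.

Lemma peierls_barrier_le (e : R) : 0 < e ->
  (peierls_barrier A x y <=
   ereal_sup (EFin @` [set s | exists n z, loop_set e n z /\ s = S n z]))%E.
Proof.
move=> e0; rewrite peierls_barrierE; apply: ge_ereal_inf; eexists.
  by exists e => //=; rewrite in_itv /= e0.
apply: ge_ereal_inf; eexists; first by exists setT; first exact: filterT.
apply: ge_ereal_sup => _ /= [n _ <-]; apply: ge_ereal_sup => _ /= [z zl <-].
by apply: ereal_sup_ubound; exists (S n z) => //; exists n, z.
Qed.

Lemma mane_potential_gt (e r : R) : 0 < e -> (r%:E < mane_potential A x y)%E ->
  exists n z, [/\ (1 <= n)%N, iter n sigma z = y, mdist x z < e & r < S n z].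
Proof.
move=> e0; rewrite mane_potentialE => rM.
have e_itv : e \in `]0, +oo[ by rewrite in_itv /= e0.
have /ereal_sup_gt[_ [n [z [n1 zy zx ->]]]] := lt_le_trans rM (ereal_inf_lbound
  (ex_intro2 _ _ e e_itv erefl)).
by rewrite lte_fin => rS; exists n, z; split => //; rewrite metric_sym.
Qed.

End barriers.

Section aubry.
Variable A : Omega -> R.
Hypothesis hA : lipschitz_potential A.
Local Notation F := (normalized A).
Local Notation S := (birkhoff_sum F).

Let normalized_lipschitz :
  exists2 L : R, 0 <= L & forall x y, `|F x - F y| <= L * mdist x y.
Proof.
have [L L0 AL] := lipschitz_constant_ge0 hA; exists L => // x y.
by rewrite /normalized opprB addrA subrK.
Qed.

Let normalized_periodic := birkhoff_sum_normalized_periodic hA.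

Lemma peierls_barrier_roundtrip x y :
  (peierls_barrier A x y + peierls_barrier A y x <= 0)%E.
Proof.
have [L L0 FL] := normalized_lipschitz.
apply/lee_addgt0Pr => e e0; rewrite add0e.
have L20 : 0 <= L *+ 2 by rewrite mulrn_wge0.
have [k [_ kL]] := exists_exp2V_small L20 e0.
have k0 : 0 < 2 ^- k :> R by rewrite invr_gt0 exprn_gt0.
apply: le_trans (leeD (peierls_barrier_le A x y k0) (peierls_barrier_le A y x k0)) _.
apply: ereal_supD_le => _ _ [n [z [[zy xz] ->]]] [m [w [[wx yw] ->]]].
apply: le_trans kL; rewrite mulrnAl.
apply: (birkhoff_sum_roundtrip L0 FL normalized_periodic zy _ wx).
  exact/agree_upto_mdist.
exact/agree_upto_mdist.
Qed.

Lemma aubry_return x k N e : aubry_set A x -> 0 < e -> exists n z,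
  [/\ (N <= n)%N, iter n sigma z = x, agree_upto k x z & - e <= S n z].
Proof.
have [L L0 FL] := normalized_lipschitz.
move=> Ax e0; pose r := e / N.+1%:R / 2.
have r0 : 0 < r by rewrite !divr_gt0.
have [l [_ lL]] := exists_exp2V_small L0 r0.
pose K := maxn k l.
have K0 : 0 < 2 ^- K :> R by rewrite invr_gt0 exprn_gt0.
have rM : ((- r)%:E < mane_potential A x x)%E by rewrite Ax lte_fin oppr_lt0.
have [n [z [n1 zx xz rS]]] := mane_potential_gt K0 rM.
have /agree_upto_mdist xzK := xz.
have [u [ux xu le_u]] := birkhoff_sum_repeat L0 FL N.+1 zx xzK.
exists (N.+1 * n)%N, u; split => //.
- by rewrite (leq_trans (leqnSn N)) // leq_pmulr.
- exact: agree_uptoW (leq_maxl _ _) xu.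
apply: le_trans le_u.
have -> : - e = (- (r *+ 2)) *+ N.+1.
  by rewrite /r -[_ *+ 2]mulr_natr divfK // mulNrn -[_ *+ N.+1]mulr_natr divfK ?pnatr_eq0.
rewrite ler_wMn2r // mulr2n.
have : L * 2 ^- K <= r.
  apply: le_trans lL; rewrite ler_wpM2l // lef_pV2 ?posrE ?exprn_gt0 //.
  by rewrite ler_eXn2l ?ltr1n // leq_maxr.
by lra.
Qed.

Lemma peierls_barrier_forward x : aubry_set A x ->
  ((F x)%:E <= peierls_barrier A x (sigma x))%E.
Proof.
move=> Ax; apply: peierls_barrier_ge => e N e0.
have [k [ke _]] := exists_exp2V_small (lexx 0) e0.
have [n [z [Nn zx xz eS]]] := aubry_return k N Ax e0.
exists (n + 1)%N, z; split.
- by rewrite (leq_trans Nn) ?leq_addr.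
- by rewrite addn1 iterS zx.
- by apply: lt_trans ke; exact/agree_upto_mdist.
- by rewrite birkhoff_sumD zx [birkhoff_sum _ 1 x]big_ord1 /=; lra.
Qed.

Lemma peierls_barrier_backward x : aubry_set A x ->
  ((- F x)%:E <= peierls_barrier A (sigma x) x)%E.
Proof.
have [L L0 FL] := normalized_lipschitz.
move=> Ax; apply: peierls_barrier_ge => e N e0.
have e20 : 0 < e / 2 by rewrite divr_gt0.
have [k [ke kL]] := exists_exp2V_small L0 e20.
have [n [z [Nn zx xz eS]]] := aubry_return k.+1 N.+1 Ax e20.
case: n Nn zx eS => // n Nn zx; rewrite -(add1n n) birkhoff_sumD.
rewrite [birkhoff_sum _ 1 z]big_ord1 /= => eS.
exists n, (sigma z); split => //.
- by rewrite -iterSr.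
- apply: (@lt_trans _ _ (2 ^- k)); last by lra.
  by apply/agree_upto_mdist => i ik; exact: xz.
- have : `|F x - F z| <= e / 2.
    apply: (le_trans (FL x z)); apply: le_trans kL; rewrite ler_wpM2l // ltW //.
    by apply/agree_upto_mdist; exact: agree_uptoW (leqnSn k) xz.
  by rewrite ler_norml => /andP[]; lra.
Qed.

End aubry.
End shift_orbits.

Theorem lemma4p3 (R : realType) (d : nat) (A : shift_space R d -> R)
    (hA : lipschitz_potential A) (x : shift_space R d) (hx : aubry_set A x) :
  (peierls_barrier A x (shift_map x) + peierls_barrier A (shift_map x) x = 0)%E.
Proof.
apply/eqP; rewrite eq_le peierls_barrier_roundtrip //=.
rewrite -(subee (x := (normalized A x)%:E)) // -EFinN.
by apply: leeD; [exact: peierls_barrier_forward | exact: peierls_barrier_backward].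
Qed.
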